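(* Let $H$ be normalised (with $q\ge 2$ the smallest period). Then $$c>2A,\qquad\text{and}\qquad c^2\Big(\tfrac12+\ln\tfrac{c}{2A}\Big)>\tfrac1q\,\mathrm{Tr}\,L^2 .$$
   Context: Let $q\ge 2$ be an integer and let $(a_n)_{n\in\mathbb Z}$, $(b_n)_{n\in\mathbb Z}$ be real sequences with $a_n>0$, $a_{n+q}=a_n$, $b_{n+q}=b_n$ for all $n$, where $q$ is the smallest common period (there is no $1\le p<q$ with $a_{n+p}=a_n$ and $b_{n+p}=b_n$ for all $n$). $H$ is the bounded self-adjoint operator on $\ell^2(\mathbb Z)$ given by $(H\psi)_n=a_{n-1}\psi_{n-1}+b_n\psi_n+a_n\psi_{n+1}$. Set $A=(a_1a_2\cdots a_q)^{1/q}$. For $\lambda\in\mathbb C$ let $\phi(\lambda),\theta(\lambda)$ be the solutions of $a_{n-1}\psi_{n-1}+b_n\psi_n+a_n\psi_{n+1}=\lambda\psi_n$ ($n\in\mathbb Z$) with $\phi_0=0,\phi_1=1$ and $\theta_0=1,\theta_1=0$; the discriminant is the degree-$q$ polynomial $D(\lambda)=\phi_{q+1}(\lambda)+\theta_q(\lambda)$. The spectrum of $H$ is $\{\lambda\in\mathbb R:|D(\lambda)|\le 2\}$, a union of the $q$ bands $[\lambda^+_{m-1},\lambda^-_m]$, $m=1,\dots,q$, with $\lambda^+_0<\lambda^-_1\le\lambda^+_1<\lambda^-_2\le\dots\le\lambda^+_{q-1}<\lambda^-_q$, separated by the gaps $\gamma_m=(\lambda^-_m,\lambda^+_m)$, $m=1,\dots,q-1$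 (a gap is open if $\lambda^-_m<\lambda^+_m$). Let $c=(\lambda^-_q-\lambda^+_0)/2$ be half the width of the spectrum. $H$ is called normalised if $\lambda^+_0=-\lambda^-_q$ (so the spectrum lies in $[-c,c]$ with endpoints $\pm c$). The $q\times q$ matrix $L$ is defined by $L=\begin{pmatrix} b_1 & a_1+ia_2\\ a_1-ia_2 & b_2\end{pmatrix}$ if $q=2$, and for $q\ge 3$ by $L_{jj}=b_j$ ($1\le j\le q$), $L_{j,j+1}=L_{j+1,j}=a_j$ ($1\le j\le q-1$), $L_{1q}=ia_q$, $L_{q1}=-ia_q$, and all other entries $0$. *)

(* Defs.v *)
From HB Require Import structures.
From mathcomp Require Import all_boot all_order all_algebra.
From mathcomp Require Import complex.
From mathcomp Require Import all_classical all_reals all_analysis.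
Set Implicit Arguments. Unset Strict Implicit. Unset Printing Implicit Defensive.
Import Order.TTheory GRing.Theory Num.Theory.
Local Open Scope ring_scope.
Local Open Scope complex_scope.

(* Coefficient sequences a, b are indexed by nat; since they are q-periodic,
   this loses nothing compared with indexing by Z (a_0 = a_q, etc.). *)

Section Jacobi.
Variable R : realType.
Implicit Types (a b : nat -> R) (q : nat).

Definition periodic_with a b p := forall n, a (n + p)%N = a n /\ b (n + p)%N = b n.
Definition minimal_period a b q :=
  (1 <= q)%N /\ periodic_with a b q /\
  forall p, (1 <= p)%N -> (p < q)%N -> ~ periodic_with a b p.

(* Solution of a_{n-1} psi_{n-1} + b_n psi_n + a_n psi_{n+1} = lam psi_n
   with psi_0 = x0, psi_1 = x1; jsol returns (psi_n, psi_{n+1}). *)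
Fixpoint jsol_pair a b (lam x0 x1 : R) (n : nat) : R * R :=
  match n with
  | 0 => (x0, x1)
  | n'.+1 => let: (u, v) := jsol_pair a b lam x0 x1 n' in
             (v, ((lam - b n) * v - a n' * u) / a n)
  end.
Definition jsol a b lam x0 x1 n := (jsol_pair a b lam x0 x1 n).1.

Definition phi a b lam n := jsol a b lam 0 1 n.
Definition theta a b lam n := jsol a b lam 1 0 n.

Definition discr a b q (lam : R) := phi a b lam q.+1 + theta a b lam q.

Definition spec a b q : set R := [set lam | `|discr a b q lam| <= 2].

Definition lam_bot a b q : R := inf (spec a b q).
Definition lam_top a b q : R := sup (spec a b q).

Definition halfwidth a b q : R := (lam_top a b q - lam_bot a b q) / 2.

Definition normalised a b q := lam_bot a b q = - lam_top a b q.

Definition geomA a q : R := powR (\prod_(i < q) a i.+1) (q%:R^-1).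

(* the matrix L; row/column index i : 'I_q stands for i+1 *)
Definition Lmat a b q : 'M[R[i]]_q :=
  \matrix_(i < q, j < q)
    if (i == j :> nat) then (b i.+1)%:C
    else if q == 2%N then
      (if (i == 0%N :> nat) then (a 1%N)%:C + 'i * (a 2%N)%:C
                     else (a 1%N)%:C - 'i * (a 2%N)%:C)
    else if (j == i.+1 :> nat) then (a i.+1)%:C
    else if (i == j.+1 :> nat) then (a j.+1)%:C
    else if (i == 0%N :> nat) && (j == q.-1 :> nat) then 'i * (a q)%:C
    else if (i == q.-1 :> nat) && (j == 0%N :> nat) then - ('i * (a q)%:C)
    else 0.

End Jacobi.

(* Main.v *)
(* Since D tends to +oo and the spectrum is {|D| <= 2}, D >= 2 at and above its top;
   such spectral parameters carry a positive solution u with q-periodic ratios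
   u_{n+1}/u_n, and p_n = a_n u_{n+1}/u_n solves a Riccati recursion.  Normalisation
   allows this at both ends c and -c, giving periodic p_n, r_n > 0 with
   p_{n+1} + a_n^2/p_n = c - b_{n+1} and r_{n+1} + a_n^2/r_n = c + b_{n+1}.
   Putting p_n + r_n = c (1 + be_n) and r_n - p_n = al_n (p_n + r_n) yields the
   Geronimus relations
     a_n^2 = (c/2)^2 (1 + be_n)(1 - be_{n+1})(1 - al_n^2),
     b_{n+1} = (c/2) ((1 + be_{n+1}) al_{n+1} - (1 - be_{n+1}) al_n)
   with |al_n|, |be_n| < 1.  Taking logarithms and summing over a period, both
   inequalities follow from ln (1 - x) <= - x, convexity of the square and
   telescoping.  Equality would force al = be = 0, hence period 1. *)
Require Import Defs.
From HB Require Import structures.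
From mathcomp Require Import all_boot all_order all_algebra.
From mathcomp Require Import complex polyrcf ring lra zify.
From mathcomp Require Import all_classical all_reals all_analysis.
Import Order.TTheory GRing.Theory Num.Theory.
Local Open Scope ring_scope.
Local Open Scope complex_scope.

(** * Polynomial functions on a real closed field: intermediate values and the last zero *)

Definition polyfun {R : rcfType} (f : R -> R) :=
  exists p : {poly R}, forall x, f x = p.[x].

Lemma polyfun_ivt {R : rcfType} {f : R -> R} (x y v : R) :
  polyfun f -> x <= y -> f x <= v <= f y ->
  exists2 z, x <= z <= y & f z = v.
Proof.
move=> [p pE] xy; rewrite !pE => fv.
have [|z zxy rz] := @Num.Theory.poly_ivt R (p - v%:P) x y xy.
  by rewrite !hornerE subr_le0 subr_ge0.
exists z => //; rewrite pE; apply/eqP; rewrite -subr_eq0.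
by move: rz; rewrite rootE !hornerE.
Qed.

Lemma polyfun_prod {R : rcfType} (f : nat -> R -> R) n :
  (forall i, polyfun (f i)) -> polyfun (fun x => \prod_(i < n) f i x).
Proof.
move=> /choice[p pE]; exists (\prod_(i < n) p i) => x.
by rewrite horner_prod; apply: eq_bigr => i _; rewrite pE.
Qed.

Lemma polyfun_last_zero {R : rcfType} {f : R -> R} (x l : R) :
  polyfun f -> f x = 0 -> (forall y, l <= y -> f y != 0) ->
  exists y, [/\ x <= y, f y = 0 & forall z, y < z -> f z != 0].
Proof.
move=> [p pE] fx fl.
have xl : x < l by rewrite ltNge; apply/negP => /fl; rewrite fx eqxx.
have p0 : p != 0.
  by apply/eqP => p0; have := fl l (lexx _); rewrite pE p0 horner0 eqxx.
have rx : root p x by rewrite rootE -pE fx.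
(* Searching from [x - 1] keeps [x] itself inside the open interval, so the case without a root is
   impossible. *)
case: (prev_rootP p (x - 1) l) => [/eqP|y _ py yI nr|c _ _ nr].
- by rewrite (negPf p0).
- have xy : x <= y.
    rewrite leNgt; apply/negP => yx.
    by have := nr x; rewrite in_itv /= yx xl rx => /(_ isT).
  exists y; split => //; first by rewrite pE.
  move=> z yz; have [/fl//|zl] := leP l z.
  by have := nr z; rewrite in_itv /= yz zl rootE -pE => /(_ isT).
- by have := nr x; rewrite in_itv /= xl rx; lra.
Qed.

(** * Solutions of the three-term recurrence: linearity, reflection, Wronskian *)

Section Solutions.
Context {R : realType}.
Implicit Types (a b : nat -> R) (lam : R).

Lemma jsol0 a b lam x0 x1 : jsol a b lam x0 x1 0 = x0.
Proof. by []. Qed.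

Lemma jsol1 a b lam x0 x1 : jsol a b lam x0 x1 1 = x1.
Proof. by []. Qed.

Lemma jsolSS a b lam x0 x1 n : jsol a b lam x0 x1 n.+2 =
  ((lam - b n.+1) * jsol a b lam x0 x1 n.+1 - a n * jsol a b lam x0 x1 n)
  / a n.+1.
Proof.
rewrite /jsol /=; case: n => [//|n] /=.
by case: (jsol_pair a b lam x0 x1 n).
Qed.

Lemma jsol_ind2 (P : nat -> Prop) :
  P 0 -> P 1 -> (forall n, P n -> P n.+1 -> P n.+2) -> forall n, P n.
Proof.
move=> P0 P1 PS n; suff: P n /\ P n.+1 by case.
by elim: n => [//|n [? ?]]; split => //; apply: PS.
Qed.

Lemma jsol_linear a b lam x0 x1 n :
  jsol a b lam x0 x1 n = x0 * theta a b lam n + x1 * phi a b lam n.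
Proof.
rewrite /theta /phi; elim/jsol_ind2: n => [||n IH1 IH2].
- by rewrite !jsol0; ring.
- by rewrite !jsol1; ring.
- by rewrite !jsolSS IH1 IH2; ring.
Qed.

Lemma polyfun_jsol a b x0 x1 n : polyfun (fun lam => jsol a b lam x0 x1 n).
Proof.
elim/jsol_ind2: n => [||n [p pE] [r rE]].
- by exists x0%:P => x; rewrite hornerC.
- by exists x1%:P => x; rewrite hornerC.
- exists ((a n.+1)^-1 *: (('X - (b n.+1)%:P) * r - a n *: p)) => x.
  by rewrite jsolSS pE rE !hornerE mulrC.
Qed.

Lemma polyfun_discr a b q : polyfun (discr a b q).
Proof.
have [p pE] := polyfun_jsol a b 0 1 q.+1.
have [r rE] := polyfun_jsol a b 1 0 q.
by exists (p + r) => x; rewrite hornerD -pE -rE.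
Qed.

(** Alternating signs turn a solution for [b] and [lam] into one for [- b] and [- lam]. Through this
    the bottom of the spectrum is handled as the top of a reflected operator. *)
Lemma jsol_reflect a b lam x0 x1 n :
  jsol a (fun k => - b k) (- lam) x0 x1 n
  = (-1) ^+ n * jsol a b lam x0 (- x1) n.
Proof.
elim/jsol_ind2: n => [||n IH1 IH2].
- by rewrite !jsol0; ring.
- by rewrite !jsol1; ring.
- by rewrite !jsolSS IH1 IH2 !exprS; ring.
Qed.

(** [phi] at [q.+1] carries one sign more than [theta] at [q]; the negated initial value cancels
    it. *)
Lemma discr_reflect a b q lam :
  discr a (fun k => - b k) q (- lam) = (-1) ^+ q * discr a b q lam.
Proof.
rewrite /discr [phi _ _ _ _]jsol_reflect [theta _ _ _ _]jsol_reflect.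
by rewrite !(@jsol_linear _ _ _ _ (- _)) exprS; ring.
Qed.

Lemma spec_reflect a b q lam :
  spec a (fun k => - b k) q lam = spec a b q (- lam).
Proof.
rewrite /spec /= -{1}[lam]opprK discr_reflect normrM.
by rewrite normrX normrN normr1 expr1n mul1r.
Qed.

Lemma lam_top_reflect a b q :
  lam_top a (fun k => - b k) q = - lam_bot a b q.
Proof.
rewrite /lam_top /lam_bot /inf opprK; congr sup.
apply/seteqP; split => x; rewrite spec_reflect /=.
  by move=> h; exists (- x) => //; rewrite opprK.
by move=> [y hy <-]; rewrite opprK.
Qed.

Lemma wronskian {a b lam} x0 x1 y0 y1 n : (forall k, 0 < a k) ->
  a n * (jsol a b lam x0 x1 n * jsol a b lam y0 y1 n.+1
         - jsol a b lam x0 x1 n.+1 * jsol a b lam y0 y1 n)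
  = a 0 * (x0 * y1 - x1 * y0).
Proof.
move=> a_gt0; elim: n => [//|n <-].
by rewrite !jsolSS; field; rewrite gt_eqF.
Qed.

End Solutions.

(** * Positive solutions at and above the top of the spectrum, and their Riccati form *)

Section Positivity.
Context {R : realType}.
Implicit Types (a b : nat -> R) (lam : R).

Lemma jsolSS_mul {a b lam} x0 x1 n : (forall k, 0 < a k) ->
  a n.+1 * jsol a b lam x0 x1 n.+2 + a n * jsol a b lam x0 x1 n
  = (lam - b n.+1) * jsol a b lam x0 x1 n.+1.
Proof. by move=> a_gt0; rewrite jsolSS; field; rewrite gt_eqF. Qed.

(** The condition on [lam] gives a_{n+1} u_{n+2} >= 3 a_{n+1} u_{n+1} + a_n (u_{n+1} - u_n), so a
    nonnegative nondecreasing start at least triples at each later step. The factor 3 serves to push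
    the discriminant past 2. *)
Lemma jsol_growth {a b lam} x0 x1 q : (forall k, 0 < a k) ->
  (forall n, (n < q)%N -> 3 * a n.+1 + a n <= lam - b n.+1) ->
  0 <= x0 -> x0 <= x1 ->
  forall n, (n <= q)%N ->
    [/\ x1 <= jsol a b lam x0 x1 n.+1, 0 <= jsol a b lam x0 x1 n,
        jsol a b lam x0 x1 n <= jsol a b lam x0 x1 n.+1 &
        (0 < n)%N -> 3 * jsol a b lam x0 x1 n <= jsol a b lam x0 x1 n.+1].
Proof.
move=> a_gt0 lam_big x0_ge0 x01; elim => [_|n IH nq].
  by split => //; rewrite ?jsol1.
have [u1 u0 uu _] := IH (ltnW nq).
have key : 3 * jsol a b lam x0 x1 n.+1 <= jsol a b lam x0 x1 n.+2.
  rewrite -(ler_pM2l (a_gt0 n.+1)).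
  have := jsolSS_mul (b := b) (lam := lam) x0 x1 n a_gt0.
  have := lam_big n nq; have := a_gt0 n.
  move: (jsol _ _ _ _ _ n.+2) (jsol _ _ _ _ _ n.+1) (jsol _ _ _ _ _ n) u0 uu.
  move=> w v u u0 uv an h e; nra.
by split => //; lra.
Qed.

Lemma phi_discr_large a b q : (forall k, 0 < a k) -> (0 < q)%N ->
  exists l, forall lam, l <= lam ->
    2 < discr a b q lam /\ forall n, (n < q)%N -> 0 < phi a b lam n.+1.
Proof.
move=> a_gt0 q_gt0.
(* Each summand covers the growth condition at its own site, and all are nonnegative, so the sum
   serves every site at once. *)
exists (\sum_(i < q) (`|b i.+1| + 3 * a i.+1 + a i)) => lam l_lam.
have lam_big n : (n < q)%N -> 3 * a n.+1 + a n <= lam - b n.+1.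
  move=> nq; apply: (@le_trans _ _ (`|b n.+1| + 3 * a n.+1 + a n - b n.+1)).
    by have := ler_norm (b n.+1); lra.
  rewrite lerD2r; apply: le_trans l_lam.
  rewrite (bigD1 (Ordinal nq)) //= lerDl; apply: sumr_ge0 => i _.
  by have := normr_ge0 (b i.+1); have := a_gt0 i; have := a_gt0 i.+1; lra.
have G0 := jsol_growth 0 1 q a_gt0 lam_big (lexx _) ler01.
(* [theta] starts with 1, 0 and is not nondecreasing, so the data 1, 1 are used, which give theta +
   phi. Then phi_{q+1} >= 3 phi_q, phi_q >= 1 and theta_q + phi_q >= 1 yield D >= 1 + 2 phi_q >=
   3. *)
have G1 := jsol_growth 1 1 q a_gt0 lam_big ler01 (lexx _).
split; last by move=> n /ltnW/G0[+ _ _ _]; rewrite /phi; lra.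
have [_ _ _ /(_ q_gt0) h1] := G0 q (leqnn _).
have [q' qE] : exists q', q = q'.+1 by exists q.-1; rewrite prednK.
have lq : (q' <= q)%N by rewrite qE.
have [h2 _ _ _] := G0 q' lq; have [h3 _ _ _] := G1 q' lq.
move: h2 h3; rewrite -qE (jsol_linear _ _ _ 1 1) /discr => h2 h3.
by move: h1 h2 h3; rewrite /phi; lra.
Qed.

(* At the largest zero y of phi_1, ..., phi_q, no interior phi_n vanishes, since its
   neighbours would have opposite signs; if phi_q(y) = 0 then phi_{q+1}(y) and
   theta_q(y) are negative with product 1, so D(y) < 0. *)
Lemma phi_gt0 a b q lam : (forall k, 0 < a k) -> a q = a 0 -> (0 < q)%N ->
  (forall x, lam <= x -> 2 <= discr a b q x) ->
  forall n, (n < q)%N -> 0 < phi a b lam n.+1.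
Proof.
move=> a_gt0 aq q_gt0 D_ge2 n nq; rewrite ltNge; apply/negP => phin.
have [l hl] := phi_discr_large a b q a_gt0 q_gt0.
have phi_ivt k x : (k < q)%N -> phi a b x k.+1 <= 0 ->
    exists2 z, x <= z & phi a b z k.+1 = 0.
  move=> kq h.
  have [||z /andP[xz _] z0] :=
    polyfun_ivt x (Num.max x l) 0 (polyfun_jsol a b 0 1 k.+1).
  - by rewrite le_max lexx.
  - rewrite h ltW //; have [|_ ->] := hl (Num.max x l) => //.
    by rewrite le_max lexx orbT.
  - by exists z.
pose f x := \prod_(i < q) phi a b x i.+1.
have f0 k x : (k < q)%N -> phi a b x k.+1 = 0 -> f x = 0.
  by move=> kq h; rewrite /f (bigD1 (Ordinal kq)) //= h mul0r.
have [z lamz /f0 fz] := phi_ivt n lam nq phin.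
have f_poly : polyfun f.
  exact: (polyfun_prod (fun i x => phi a b x i.+1) q
            (fun i => polyfun_jsol a b 0 1 i.+1)).
have [||y [zy fy fy']] := polyfun_last_zero z l f_poly.
- exact: fz.
- move=> x lx; apply/prodf_neq0 => i _.
  by rewrite gt_eqF //; have [_ ->] := hl x lx.
(* A negative value at [y] would force a zero of [f] strictly beyond [y], since every factor is
   positive for large parameters. *)
have phi_ge0 k : (k < q)%N -> 0 <= phi a b y k.+1.
  move=> kq; rewrite leNgt; apply/negP => h.
  have [x yx x0] := phi_ivt k y kq (ltW h).
  have := fy' x; rewrite (f0 k) // eqxx => /(_ _)/negP; apply => //.
  rewrite lt_neqAle yx andbT; apply/eqP => xy.
  by move: h; rewrite xy x0 ltxx.
have /prodf_eq0[i _ /eqP /= phi0] : f y == 0 by apply/eqP.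
have W k := wronskian (a := a) (b := b) (lam := y) 1 0 0 1 k a_gt0.
case: i phi0 => -[|k] /= kq phi0.
  by move: phi0; rewrite /phi jsol1 => /eqP; rewrite oner_eq0.
have rec := jsolSS_mul (b := b) (lam := y) 0 1 k.+1 a_gt0.
rewrite -!/(phi _ _ _ _) phi0 mulr0 in rec.
have phik := phi_ge0 k (ltnW kq).
have := W k.+2.
rewrite mul0r subr0 mulr1 -!/(phi _ _ _ _) -!/(theta _ _ _ _) phi0 mulr0 subr0.
have ak := a_gt0 k.+1; have ak' := a_gt0 k.+2; have a0 := a_gt0 0%N.
have phi_le0 : phi a b y k.+3 <= 0 by nra.
move=> Wk.
have [kq'|qk] := ltnP k.+2 q.
  have := phi_ge0 _ kq' => phi3.
  have phi30 : phi a b y k.+3 = 0 by lra.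
  by move: Wk; rewrite phi30 !mulr0; lra.
have qE : q = k.+2 by lia.
have := D_ge2 y (le_trans lamz zy); rewrite /discr qE leNgt => /negP; apply.
have W1 : theta a b y k.+2 * phi a b y k.+3 = 1.
  by move: Wk; rewrite -qE aq => /(mulfI (lt0r_neq0 a0)) h; nra.
nra.
Qed.

(** The monodromy matrix has determinant 1 and trace D >= 2, hence a positive eigenvalue [mu]. The
    solution [psi] that gains the factor [mu] over a period is positive, and dividing its recurrence
    by psi_{n+1} gives the Riccati equation for a_n psi_{n+1} / psi_n. *)
Lemma riccati_exists a b q lam :
  (0 < q)%N -> periodic_with a b q -> (forall k, 0 < a k) ->
  (forall x, lam <= x -> 2 <= discr a b q x) ->
  exists p : nat -> R, [/\ forall n, 0 < p n, forall n, p (n + q)%N = p n &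
    forall n, p n.+1 + a n ^+ 2 / p n = lam - b n.+1].
Proof.
move=> q_gt0 per a_gt0 D_ge2.
have aq : a q = a 0%N by have [] := per 0%N.
have phi_pos := phi_gt0 a b q lam a_gt0 aq q_gt0 D_ge2.
have phiq : 0 < phi a b lam q by have := phi_pos q.-1; rewrite prednK //; apply; lia.
pose D := discr a b q lam.
have D2 : 2 <= D := D_ge2 lam (lexx _).
have [mu [mu_gt0 muE]] : exists mu : R, 0 < mu /\ mu ^+ 2 - D * mu + 1 = 0.
  exists ((D + Num.sqrt (D ^+ 2 - 4)) / 2).
  have s2 : Num.sqrt (D ^+ 2 - 4) ^+ 2 = D ^+ 2 - 4 by rewrite sqr_sqrtr //; nra.
  have s0 := sqrtr_ge0 (D ^+ 2 - 4).
  by split; [lra | move: (Num.sqrt _) s2 s0 => s s2 s0; nra].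
(* These initial values form an eigenvector of the monodromy matrix for [mu]. *)
pose psi n := jsol a b lam (phi a b lam q) (mu - theta a b lam q) n.
have W1 : theta a b lam q * phi a b lam q.+1 - theta a b lam q.+1 * phi a b lam q = 1.
  have := wronskian (a := a) (b := b) (lam := lam) 1 0 0 1 q a_gt0.
  by rewrite aq => /(mulfI (lt0r_neq0 (a_gt0 0%N))); rewrite mulr1 mul0r subr0.
have psi_per n : psi (n + q)%N = mu * psi n.
  elim/jsol_ind2: n => [||n IH1 IH2].
  - by rewrite add0n /psi jsol_linear jsol0; ring.
  - rewrite add1n /psi jsol_linear jsol1.
    rewrite /D /discr in muE.
    move: (phi _ _ _ _) (phi _ _ _ _) (theta _ _ _ _) (theta _ _ _ _) W1 muE.
    move=> f g t s W1 muE; nra.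
  - have [an bn] := per n.+1; have [an' _] := per n.
    rewrite addSn in an bn.
    rewrite /psi addSn addSn jsolSS an bn an' -addSn -/(psi _) -/(psi _) IH1 IH2.
    by rewrite /psi jsolSS; ring.
(* By the Wronskian with phi, psi / phi decreases to mu at q. *)
have psi_pos_q n : (n < q)%N -> 0 < psi n.
  case: n => [_|n nq]; first by rewrite /psi jsol0.
  have W k := wronskian (a := a) (b := b) (lam := lam) (phi a b lam q)
    (mu - theta a b lam q) 0 1 k a_gt0.
  have dec k : psi k * phi a b lam k.+1 > psi k.+1 * phi a b lam k.
    rewrite -subr_gt0 -(pmulr_rgt0 _ (a_gt0 k)) W mulr0 subr0 mulr1.
    by rewrite mulr_gt0.
  suff H k : (k < q)%N -> mu * phi a b lam (q - k) <= psi (q - k)%N.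
    have := H (q - n.+1)%N; rewrite subKn ?(ltnW nq) // => /(_ _) h.
    apply: lt_le_trans (h _); last by lia.
    by rewrite mulr_gt0 // phi_pos // ltnW.
  elim: k => [_|k IH kq].
    by rewrite subn0 -[X in psi X]add0n psi_per /psi jsol0.
  have [m mE] : exists m, (q - k.+1 = m.+1)%N by exists (q - k.+1).-1; lia.
  have mE' : (q - k = m.+2)%N by lia.
  move: (IH (ltnW kq)); rewrite mE mE' => {}IH.
  have f1 : 0 < phi a b lam m.+1 by apply: phi_pos; lia.
  have f2 : 0 < phi a b lam m.+2 by apply: phi_pos; lia.
  have := dec m.+1.
  by rewrite -(ler_pM2r f2) => h; nra.
have psi_pos n : 0 < psi n.
  rewrite (divn_eq n q) addnC; elim: (n %/ q)%N => [|k IH].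
    by rewrite addn0 psi_pos_q // ltn_mod.
  by rewrite mulSn addnCA addnC psi_per mulr_gt0.
exists (fun n => a n * psi n.+1 / psi n); split => n.
- by rewrite divr_gt0 // mulr_gt0.
- have [-> _] := per n; rewrite -addSn !psi_per.
  move: (psi n.+1) (psi n) (psi_pos n) => v u u_gt0.
  by field; rewrite !gt_eqF.
- have := jsolSS_mul (b := b) (lam := lam) (phi a b lam q)
    (mu - theta a b lam q) n a_gt0.
  rewrite -!/(psi _); have := psi_pos n; have := psi_pos n.+1.
  move: (psi n.+2) (psi n.+1) (psi n) (a_gt0 n) (a_gt0 n.+1).
  move=> w v u an an' v0 u0 e.
  apply: (mulIf (lt0r_neq0 v0)); rewrite -e.
  by field; rewrite !gt_eqF.
Qed.

(** Where D is below 2, the intermediate value theorem on the way to large parameters yields a point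
    of the spectrum strictly further right. *)
Lemma discr_ge2_above a b q :
  (0 < q)%N -> periodic_with a b q -> (forall k, 0 < a k) ->
  forall x, lam_top a b q <= x -> 2 <= discr a b q x.
Proof.
move=> q_gt0 per a_gt0.
have [l hl] := phi_discr_large a b q a_gt0 q_gt0.
have cross x : discr a b q x < 2 -> exists2 z, x < z & spec a b q z.
  move=> Dx.
  have [||z /andP[xz _] z2] := polyfun_ivt x (Num.max x l) 2 (polyfun_discr a b q).
  - by rewrite le_max lexx.
  - by rewrite (ltW Dx) ltW //; have [] := hl (Num.max x l); rewrite // le_max lexx orbT.
  exists z; last by rewrite /spec /= z2 ger0_norm.
  by rewrite lt_neqAle xz andbT; apply/eqP => xE; move: Dx; rewrite xE z2 ltxx.
(* [sup] is meaningful only for a nonempty set. If the spectrum were empty, the Riccati solution at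
   [lam] = b_1 would give p_1 + a_0^2 / p_0 = 0 with both terms positive. *)
have spec_nonempty : exists z, spec a b q z.
  apply: contrapT => none.
  have D_ge2 x : b 1%N <= x -> 2 <= discr a b q x.
    by move=> _; rewrite leNgt; apply/negP => /cross[z _ hz]; apply: none; exists z.
  have [p [p_gt0 _ /(_ 0%N)]] := riccati_exists a b q (b 1%N) q_gt0 per a_gt0 D_ge2.
  have : 0 < a 0%N ^+ 2 / p 0%N by rewrite divr_gt0 // exprn_gt0.
  by have := p_gt0 1%N; lra.
have sup_spec : has_sup (spec a b q).
  split => //; exists l => z /= hz; rewrite leNgt; apply/negP => lz.
  have [D2 _] := hl z (ltW lz); move: hz; rewrite /spec /= leNgt => /negP; apply.
  exact: lt_le_trans D2 (ler_norm _).
move=> x top_x; rewrite leNgt; apply/negP => /cross[z xz hz].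
have := sup_upper_bound sup_spec hz.
by rewrite leNgt => /negP; apply; exact: le_lt_trans top_x xz.
Qed.

End Positivity.

(** * The trace of the square of L *)

Section Trace.
Context {R : realType}.
Implicit Types (a b : nat -> R).

(** The two imaginary corner entries multiply to a_q^2, so the cyclic successor [ordS] treats them
    like any other off-diagonal pair. For [3 <= q] the three conditions exclude one another. *)
Lemma Lmat_mul_entry a b q (i j : 'I_q) : (3 <= q)%N ->
  Lmat a b q i j * Lmat a b q j i =
  ((if j == i then b i.+1 ^+ 2 else 0)
   + (if j == ordS i then a i.+1 ^+ 2 else 0)
   + (if i == ordS j then a j.+1 ^+ 2 else 0))%:C.
Proof.
move=> q3; rewrite !mxE -!val_eqE /=.
have qN2 : (q == 2%N) = false by lia.
have S_val (k : 'I_q) : (k.+1 %% q = if k.+1 == q then 0 else k.+1)%N.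
  case: eqP => [->|/eqP kq]; first by rewrite modnn.
  by rewrite modn_small //; have := ltn_ord k; lia.
rewrite !S_val qN2 [(i == j :> nat)]eq_sym.
have ltiq := ltn_ord i; have ltjq := ltn_ord j.
have i2 : 'i%C * 'i%C = -1 :> R[i] by rewrite -expr2 sqr_i.
have [ji|ji] := eqVneq (j : nat) i.
  rewrite ji; have -> : (i == (if i.+1 == q then 0 else i.+1) :> nat) = false.
    by case: ifP => ?; lia.
  by rewrite !addr0 -rmorphM.
have [jSi|jSi] := eqVneq (j : nat) i.+1.
  have -> : (i.+1 == q) = false by lia.
  have -> : (i == j.+1 :> nat) = false by lia.
  rewrite jSi eqxx; have -> : (i == (if i.+2 == q then 0 else i.+2) :> nat) = false.
    by case: ifP => ?; lia.
  by rewrite add0r addr0 -rmorphM.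
have [iSj|iSj] := eqVneq (i : nat) j.+1.
  have -> : (j.+1 == q) = false by lia.
  rewrite iSj eqxx.
  have -> : (j == (if j.+2 == q then 0 else j.+2) :> nat) = false.
    by case: ifP => ?; lia.
  by rewrite !add0r -rmorphM.
have [iq|iq] := eqVneq i.+1 q; have [jq|jq] := eqVneq j.+1 q.
- by lia.
- have [j0|j0] := eqVneq (j : nat) 0%N.
    have -> : (i == 0%N :> nat) = false by lia.
    have -> : (i == q.-1 :> nat) by lia.
    have -> : (i == j.+1 :> nat) = false by lia.
    by rewrite j0 /= iq add0r addr0 mulNr mulrACA i2 mulN1r opprK -rmorphM.
  rewrite !andbF /=; have -> : (j == q.-1 :> nat) = false by lia.
  by rewrite (negPf iSj) !andbF mul0r !addr0.
- have [i0|i0] := eqVneq (i : nat) 0%N.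
    have -> : (j == 0%N :> nat) = false by lia.
    have -> : (j == q.-1 :> nat) by lia.
    by rewrite (negPf jSi) i0 /= jq !add0r mulrN mulrACA i2 mulN1r opprK -rmorphM.
  have -> : (i == q.-1 :> nat) = false by lia.
  by rewrite (negPf jSi) /= mul0r !addr0.
- rewrite (negPf iSj) (negPf jSi).
  have -> : (i == q.-1 :> nat) = false by lia.
  have -> : (j == q.-1 :> nat) = false by lia.
  by rewrite !andbF mul0r !addr0.
Qed.

Lemma trace_Lmat_sqr a b q : (2 <= q)%N ->
  \tr (Lmat a b q ^+ 2) = (\sum_(i < q) (b i.+1 ^+ 2 + 2 * a i.+1 ^+ 2))%:C.
Proof.
move=> q2; have trE : \tr (Lmat a b q ^+ 2) =
    \sum_(i < q) \sum_(j < q) Lmat a b q i j * Lmat a b q j i.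
  by rewrite /mxtrace; apply: eq_bigr => i _; rewrite expr2 mxE.
rewrite trE; have [q3|q3] := ltnP 2 q; last first.
  (* For q = 2 both couplings share one entry, so the matrix is expanded directly. *)
  have {q2 q3 trE} -> : q = 2%N by lia.
  rewrite !big_ord_recl !big_ord0 !mxE /=.
  apply/eqP; rewrite /bump eq_complex /=.
  by apply/andP; split; apply/eqP; ring.
under eq_bigr => i _ do (under eq_bigr => j _ do rewrite Lmat_mul_entry //).
under eq_bigr => i _ do rewrite -rmorph_sum.
rewrite -rmorph_sum; congr (_%:C).
under eq_bigr => i _ do rewrite !big_split /= -!big_mkcond /= !big_pred1_eq.
rewrite !big_split /= -addrA; congr (_ + _).
(* Summing over [i] first leaves one term for each [j], the second copy of a_{j+1}^2. *)
rewrite (exchange_big_dep predT) //=.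
under [X in _ + X = _]eq_bigr => i _ do rewrite big_pred1_eq.
by rewrite -big_split; apply: eq_bigr => i _ /=; ring.
Qed.

End Trace.

(** * Logarithmic sum inequalities for periodic Geronimus parameters *)

Section SumRule.
Context {R : realType}.
Implicit Types (a b : nat -> R).

Lemma ln_prod a n : (forall k, 0 < a k) ->
  ln (\prod_(i < n) a i) = \sum_(i < n) ln (a i).
Proof.
move=> a_gt0; elim: n => [|n IH]; first by rewrite !big_ord0 ln1.
by rewrite !big_ord_recr /= lnM ?IH // posrE ?prodr_gt0.
Qed.

(** Logarithm of the strict inequality 1 + y < exp y at y = - x. *)
Lemma ln1B_lt (x : R) : 0 < x < 1 -> ln (1 - x) + x < 0.
Proof.
move=> /andP[x0 x1]; have nx : - x != 0 by rewrite oppr_eq0 gt_eqF.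
have := expR_gt1Dx nx; rewrite -ltr_ln ?posrE ?expR_gt0 //; last by lra.
by rewrite expRK; lra.
Qed.

Lemma ln1B_sqr_le (x : R) : x ^+ 2 < 1 ->
  ln (1 - x ^+ 2) + x ^+ 2 <= 0 ?= iff (x == 0).
Proof.
move=> x1; apply/leifP; case: eqVneq => [->|x0].
  by rewrite expr0n /= subr0 ln1 addr0.
by apply: ln1B_lt; rewrite x1 andbT exprn_even_gt0.
Qed.

Lemma sum_telescope (f : nat -> R) n : \sum_(i < n) (f i.+1 - f i) = f n - f 0%N.
Proof.
elim: n => [|n IH]; first by rewrite big_ord0 subrr.
by rewrite big_ord_recr /= IH; ring.
Qed.

Lemma sum_shift (f : nat -> R) n : f n = f 0%N ->
  \sum_(i < n) f i.+1 = \sum_(i < n) f i.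
Proof.
by move=> fn; apply/eqP; rewrite -subr_eq0 -sumrB sum_telescope fn subrr.
Qed.

Variables (q : nat) (al be : nat -> R).
Hypothesis al_sqr : forall n, al n ^+ 2 < 1.
Hypothesis be_gt : forall n, -1 < be n.
Hypothesis be_lt : forall n, be n < 1.

(** The remainder of both logarithms after their first-order terms; it is the source of strictness
    in both inequalities. *)
Definition defect n :=
  ln (1 - be n ^+ 2) + be n ^+ 2 + (ln (1 - al n ^+ 2) + al n ^+ 2).

Lemma be_sqr n : be n ^+ 2 < 1.
Proof.
have := be_gt n; have := be_lt n => lt gt.
rewrite -subr_gt0 (_ : _ - _ = (1 - be n) * (1 + be n)); last by ring.
by rewrite mulr_gt0 //; lra.
Qed.

Lemma defect_le0 n : defect n <= 0 ?= iff ((be n == 0) && (al n == 0)).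
Proof.
have := leifD (ln1B_sqr_le _ (be_sqr n)) (ln1B_sqr_le _ (al_sqr n)).
by rewrite addr0.
Qed.


Variables (c : R) (a b : nat -> R).
Hypothesis c_gt0 : 0 < c.
Hypothesis a_gt0 : forall n, 0 < a n.
Hypothesis be_per : be q = be 0.
Hypothesis al_per : al q = al 0.
Hypothesis aE : forall n, a n ^+ 2 =
  (c / 2) ^+ 2 * ((1 + be n) * (1 - be n.+1) * (1 - al n ^+ 2)).
Hypothesis bE : forall n, b n.+1 =
  (c / 2) * ((1 + be n.+1) * al n.+1 - (1 - be n.+1) * al n).

(** Logarithm of [aE], with ln (1 + be_n) written as ln (1 - be_n^2) - ln (1 - be_n) so that the
    remaining logarithms telescope. *)
Lemma ln_coefE n : 2 * (ln (a n) - ln (c / 2)) =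
  (ln (1 - be n.+1) - ln (1 - be n)) + defect n - be n ^+ 2 - al n ^+ 2.
Proof.
have lt n' : 0 < 1 - be n' by rewrite subr_gt0.
have gt n' : 0 < 1 + be n' by have := be_gt n'; lra.
have lta : 0 < 1 - al n ^+ 2 by rewrite subr_gt0.
have c2 : 0 < c / 2 by rewrite divr_gt0.
have := congr1 (@ln R) (aE n).
rewrite !lnM ?lnXn // ?posrE ?mulr_gt0 ?exprn_gt0 //.
rewrite /defect (_ : 1 - be n ^+ 2 = (1 - be n) * (1 + be n)); last by ring.
by rewrite lnM ?posrE //; lra.
Qed.

(** Potential whose increments cancel over a period: its terms absorb, in order, the convexity bound
    on b^2, the telescoping logarithms, the linear part of a^2 and the squares of [be]. *)
Let V n := 2 * (1 + be n) * al n ^+ 2 + 2 * ln (1 - be n) - 2 * be n + be n ^+ 2.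

Lemma local_bound n :
  4 / c ^+ 2 * (b n.+1 ^+ 2 + 2 * a n ^+ 2)
  + 4 * (ln (a n) - ln (c / 2)) - 2 <= V n.+1 - V n + 2 * defect n.
Proof.
have -> : 4 * (ln (a n) - ln (c / 2)) = 2 * (2 * (ln (a n) - ln (c / 2))) by ring.
rewrite ln_coefE /V aE bE.
rewrite (_ : 4 / c ^+ 2 * _ =
  ((1 + be n.+1) * al n.+1 - (1 - be n.+1) * al n) ^+ 2
  + 2 * ((1 + be n) * (1 - be n.+1) * (1 - al n ^+ 2))); last first.
  by field; rewrite gt_eqF.
have := be_gt n; have := be_gt n.+1; have := be_lt n; have := be_lt n.+1.
have := al_sqr n.
move: (be n) (be n.+1) (al n) (al n.+1) (defect n) (ln _) (ln _).
move=> be0 be1 al0 al1 d l1 l0 al0_lt be1_lt be0_lt be1_gt be0_gt.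
(* Convexity of the square at al1 and - al0 with weights (1 + be1) / 2 and (1 - be1) / 2. *)
have convex : ((1 + be1) * al1 - (1 - be1) * al0) ^+ 2 <=
    2 * (1 + be1) * al1 ^+ 2 + 2 * (1 - be1) * al0 ^+ 2.
  rewrite -subr_ge0 (_ : _ - _ = (1 - be1) * (1 + be1) * (al1 + al0) ^+ 2);
    last by ring.
  by apply: mulr_ge0; [apply: mulr_ge0; lra | exact: sqr_ge0].
(* The product be0 be1 left over from a^2 is absorbed by the squares, as the factor 1 - al0^2 lies
   between 0 and 1. *)
have cross : - 2 * (be0 * be1) * (1 - al0 ^+ 2) <= be0 ^+ 2 + be1 ^+ 2.
  rewrite -subr_ge0 (_ : _ - _ = (1 - al0 ^+ 2) * (be0 + be1) ^+ 2
    + al0 ^+ 2 * (be0 ^+ 2 + be1 ^+ 2)); last by ring.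
  apply: addr_ge0; apply: mulr_ge0; try exact: sqr_ge0; first by lra.
  by apply: addr_ge0; exact: sqr_ge0.
lra.
Qed.

Lemma sum_defect_lt0 : (exists2 n, (n < q)%N & (be n != 0) || (al n != 0)) ->
  \sum_(i < q) defect i < 0.
Proof.
move=> [n nq n0]; rewrite lt_neqAle sumr_le0 ?andbT; last first.
  by move=> i _; rewrite defect_le0.
rewrite -oppr_eq0 -sumrN psumr_neq0 => [|i _]; last first.
  by rewrite oppr_ge0 defect_le0.
apply/hasP; exists (Ordinal nq); rewrite ?mem_index_enum //=.
by rewrite oppr_gt0 (lt_leif (defect_le0 n)) negb_and.
Qed.

(** Logarithmic form of 2A < c: the squares in [ln_coefE] are dropped and the rest telescopes up to
    the defects. *)
Lemma sum_ln_coef_lt0 : (exists2 n, (n < q)%N & (be n != 0) || (al n != 0)) ->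
  \sum_(i < q) (ln (a i) - ln (c / 2)) < 0.
Proof.
move=> /sum_defect_lt0 def_lt0; rewrite -(pmulr_rlt0 _ (ltr0Sn R 1)) mulr_sumr.
apply: le_lt_trans def_lt0.
apply: (@le_trans _ _ (\sum_(i < q) (ln (1 - be i.+1) - ln (1 - be i) + defect i))).
  apply: ler_sum => i _; rewrite ln_coefE.
  by have := sqr_ge0 (be i); have := sqr_ge0 (al i); lra.
rewrite big_split /= (sum_telescope (fun i => ln (1 - be i))).
by rewrite be_per subrr add0r.
Qed.

(** The second inequality before normalisation: [local_bound] is summed, and [V] cancels by
    periodicity. *)
Lemma sum_rule : (exists2 n, (n < q)%N & (be n != 0) || (al n != 0)) ->
  4 / c ^+ 2 * \sum_(i < q) (b i.+1 ^+ 2 + 2 * a i ^+ 2)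
  + 4 * \sum_(i < q) (ln (a i) - ln (c / 2)) < 2 * q%:R.
Proof.
move=> /sum_defect_lt0 def_lt0; rewrite -subr_lt0.
have -> : 2 * q%:R = \sum_(i < q) 2 :> R by rewrite sumr_const card_ord mulr_natr.
rewrite !mulr_sumr -big_split -sumrB /=.
apply: le_lt_trans (_ : _ <= \sum_(i < q) (V i.+1 - V i + 2 * defect i)) _.
  by apply: ler_sum => i _; exact: local_bound.
rewrite big_split /= sum_telescope /V be_per al_per subrr add0r -mulr_sumr.
by rewrite pmulr_rlt0.
Qed.

End SumRule.

(** * From the two Riccati solutions to the Geronimus parameters *)

Lemma parameters_of_riccati {R : realType} (a b p r : nat -> R) c :
  (forall n, 0 < a n) -> (forall n, 0 < p n) -> (forall n, 0 < r n) ->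
  (forall n, p n.+1 + a n ^+ 2 / p n = c - b n.+1) ->
  (forall n, r n.+1 + a n ^+ 2 / r n = c + b n.+1) ->
  let al n := (r n - p n) / (p n + r n) in
  let be n := (p n + r n) / c - 1 in
  0 < c /\ forall n,
  [/\ al n ^+ 2 < 1, -1 < be n, be n.+1 < 1,
      a n ^+ 2 = (c / 2) ^+ 2 * ((1 + be n) * (1 - be n.+1) * (1 - al n ^+ 2)) &
      b n.+1 = (c / 2) * ((1 + be n.+1) * al n.+1 - (1 - be n.+1) * al n)].
Proof.
move=> a_gt0 p_gt0 r_gt0 pE rE al be.
have ap n : 0 < a n ^+ 2 / p n by rewrite divr_gt0 ?exprn_gt0.
have ar n : 0 < a n ^+ 2 / r n by rewrite divr_gt0 ?exprn_gt0.
have c_gt0 : 0 < c.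
  have := pE 0%N; have := rE 0%N; have := ap 0%N; have := ar 0%N.
  by have := p_gt0 1%N; have := r_gt0 1%N; lra.
split => // n; rewrite {}/al {}/be.
have := pE n; have := rE n; have := ap n; have := ar n.
have := p_gt0 n; have := r_gt0 n; have := p_gt0 n.+1; have := r_gt0 n.+1.
have := a_gt0 n.
move: (p n.+1) (r n.+1) (p n) (r n) (a n) (b n.+1).
move=> p' r' {}p {}r {}a {}b {}a_gt0 r'_gt0 p'_gt0 {}r_gt0 {}p_gt0 {}ar {}ap {}rE {}pE.
have p0 := lt0r_neq0 p_gt0; have r0 := lt0r_neq0 r_gt0.
have c0 := lt0r_neq0 c_gt0; have a0 := lt0r_neq0 a_gt0.
have s0 : p + r != 0 by rewrite gt_eqF // addr_gt0.
have s0' : p' + r' != 0 by rewrite gt_eqF // addr_gt0.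
(* The sum of the two Riccati equations; it yields be_{n+1} < 1 and the formula for a^2, while their
   difference yields b. *)
have t_eq : 1 - ((p' + r') / c - 1) = (a ^+ 2 / p + a ^+ 2 / r) / c.
  have -> : a ^+ 2 / p + a ^+ 2 / r = 2 * c - (p' + r') by lra.
  by field.
split.
- rewrite -subr_gt0 (_ : _ - _ = 4 * p * r / (p + r) ^+ 2); last by field.
  by rewrite divr_gt0 ?exprn_gt0 ?mulr_gt0 ?addr_gt0.
- have : 0 < (p + r) / c by rewrite divr_gt0 ?addr_gt0.
  by lra.
- by rewrite -subr_gt0 t_eq divr_gt0 // addr_gt0.
- by rewrite t_eq; field; rewrite p0 r0 c0 s0.
- rewrite t_eq.
  have -> : b = (r' - p') / 2 - (a ^+ 2 / p - a ^+ 2 / r) / 2 by lra.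
  by field; rewrite p0 r0 c0 s0 s0'.
Qed.

(** * Assembly: both spectral edges, nontrivial parameters, geometric mean and trace *)

Theorem theorem1 (R : realType) (q : nat) (a b : nat -> R) :
  (2 <= q)%N ->
  minimal_period a b q ->
  (forall n, 0 < a n) ->
  normalised a b q ->
  let c := halfwidth a b q in
  let A := geomA a q in
  2 * A < c /\
  (q%:R^-1)%:C * \tr (Lmat a b q ^+ 2) < (c ^+ 2 * (2^-1 + ln (c / (2 * A))))%:C.
Proof.
move=> q2 [q_gt0 [per min_per]] a_gt0 norm c A.
have c_top : c = lam_top a b q.
  by rewrite /c /halfwidth; move: norm; rewrite /normalised => ->; field.
have per' : periodic_with a (fun k => - b k) q.
  by move=> n; have [-> ->] := per n.
have [p [p_gt0 p_per pE]] := riccati_exists a b q c q_gt0 per a_gt0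
  (fun x h => discr_ge2_above a b q q_gt0 per a_gt0 x
     (eq_ind _ (fun y => y <= x) h _ c_top)).
(* Normalisation makes [c] also the top of the reflected spectrum, so [r] exists at the same
   parameter as [p]. *)
have c_top' : c = lam_top a (fun k => - b k) q.
  by rewrite lam_top_reflect norm opprK.
have [r [r_gt0 r_per rE]] := riccati_exists a (fun k => - b k) q c q_gt0 per' a_gt0
  (fun x h => discr_ge2_above a (fun k => - b k) q q_gt0 per' a_gt0 x
     (eq_ind _ (fun y => y <= x) h _ c_top')).
clearbody c.
have rE' n : r n.+1 + a n ^+ 2 / r n = c + b n.+1 by rewrite rE opprK.
have := parameters_of_riccati a b p r c a_gt0 p_gt0 r_gt0 pE rE'.
set al := fun n => (r n - p n) / (p n + r n).
set be := fun n => (p n + r n) / c - 1.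
move=> /= [c_gt0 par].
have al_per n : al (n + q)%N = al n by rewrite /al p_per r_per.
have be_per n : be (n + q)%N = be n by rewrite /be p_per r_per.
have al_sqr n : al n ^+ 2 < 1 by have [] := par n.
have be_gt n : -1 < be n by have [] := par n.
(* The Riccati equations bound [be] only at successors; index 0 is reached by shifting a full
   period. *)
have be_lt n : be n < 1.
  by rewrite -be_per -(prednK q_gt0) addnS; have [] := par (n + q.-1)%N.
have aE n : a n ^+ 2 = (c / 2) ^+ 2 * ((1 + be n) * (1 - be n.+1) * (1 - al n ^+ 2)).
  by have [] := par n.
have bE n : b n.+1 = (c / 2) * ((1 + be n.+1) * al n.+1 - (1 - be n.+1) * al n).
  by have [] := par n.
have nonzero : exists2 n, (n < q)%N & (be n != 0) || (al n != 0).
  apply: contrapT => none.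
  have zero_q n : (n < q)%N -> be n = 0 /\ al n = 0.
    move=> nq; split; apply/eqP; apply: contrapT => /negP h; apply: none;
      by exists n; rewrite // h ?orbT.
  have mod_per (f : nat -> R) n : (forall k, f (k + q)%N = f k) -> f n = f (n %% q)%N.
    move=> fq; rewrite {1}(divn_eq n q) addnC; elim: (n %/ q)%N => [|k IH].
      by rewrite addn0.
    by rewrite mulSn addnCA addnC fq.
  have be0 n : be n = 0 by rewrite mod_per // (zero_q _ _).1 // ltn_mod.
  have al0 n : al n = 0 by rewrite mod_per // (zero_q _ _).2 // ltn_mod.
  have a_const n : a n = c / 2.
    have c2 : 0 <= c / 2 by rewrite divr_ge0 ?ltW.
    apply/eqP; rewrite -(eqrXn2 (n := 2)) //; last exact: ltW.
    by rewrite aE !be0 al0; apply/eqP; ring.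
  have b_zero : forall n, b n = 0.
    move=> n; have [_ <-] := per n.
    by rewrite -(prednK q_gt0) addnS bE !al0; ring.
  by apply: (min_per 1%N) => // k; rewrite !a_const !b_zero.
have beq : be q = be 0%N by exact: (be_per 0%N).
have alq : al q = al 0%N by exact: (al_per 0%N).
have aq : a q = a 0%N by have [] := per 0%N.
have lna_lt0 := sum_ln_coef_lt0 q al be al_sqr be_gt be_lt c a c_gt0 a_gt0 beq aE nonzero.
have rule := sum_rule q al be al_sqr be_gt be_lt c a b c_gt0 a_gt0 beq alq aE bE nonzero.
have qR : 0 < q%:R :> R by rewrite ltr0n.
have A_gt0 : 0 < A by rewrite powR_gt0 // prodr_gt0.
have lnA : q%:R * ln A = \sum_(i < q) ln (a i).
  rewrite /A /geomA ln_powR mulrA divff ?mul1r ?gt_eqF //.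
  (* [A] uses a_1, ..., a_q while the sums run over a_0, ..., a_{q-1}; periodicity identifies
     them. *)
  rewrite (ln_prod (fun i => a i.+1)) // (sum_shift (fun i => ln (a i))) //.
  by rewrite aq.
clearbody A.
have c2 : 0 < c / 2 by rewrite divr_gt0.
have lnE : \sum_(i < q) (ln (a i) - ln (c / 2)) = - (q%:R * ln (c / (2 * A))).
  rewrite sumrB sumr_const card_ord -lnA (_ : c / (2 * A) = (c / 2) / A).
    by rewrite (@ln_div _ (c / 2)) ?posrE // -(mulr_natl _ q); ring.
  by field; rewrite gt_eqF.
move: lna_lt0 rule; rewrite lnE => lna_lt0 rule; split.
  have : 0 < ln (c / (2 * A)) by rewrite -(pmulr_rgt0 _ qR); lra.
  rewrite -[X in X < _](@ln1 R) ltr_ln ?posrE ?divr_gt0 ?mulr_gt0 //.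
  by rewrite ltr_pdivlMr ?mul1r ?mulr_gt0.
have trE : \sum_(i < q) (b i.+1 ^+ 2 + 2 * a i ^+ 2)
    = \sum_(i < q) (b i.+1 ^+ 2 + 2 * a i.+1 ^+ 2).
  rewrite !big_split /=; congr (_ + _).
  by rewrite (sum_shift (fun i => 2 * a i ^+ 2)) // aq.
(* Both sides are images of reals, so the order on [R[i]] reduces to that on [R]. *)
rewrite trace_Lmat_sqr // -trE -rmorphM ltcR.
rewrite ltr_pdivrMl //.
move: rule; move: (\sum_(i < q) _) (ln _) => S l rule.
have c4 : 0 < 4 / c ^+ 2 by rewrite divr_gt0 ?exprn_gt0.
rewrite -(ltr_pM2l c4).
have -> : 4 / c ^+ 2 * (q%:R * (c ^+ 2 * (2^-1 + l))) = 2 * q%:R + 4 * (q%:R * l).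
  by field; rewrite gt_eqF.
by lra.
Qed.
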